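(* Let $\boldsymbol\mu\in\mathbb{C}_+^n$ have distinct entries, so that $\mathcal{V}(\boldsymbol\mu)=\operatorname{span}\{v[\mu_k]\}_{k=1}^n$ is an $n$-dimensional subspace of $\mathcal{H}_2$, and let $\boldsymbol\lambda\in\mathbb{C}_-^r$ have distinct entries, so that $\mathcal{T}(\boldsymbol\lambda)=\operatorname{span}\{v[-\overline{\lambda_j}],v[-\overline{\lambda_j}]'\}_{j=1}^r$ is a $2r$-dimensional subspace of $\mathcal{H}_2$. Let $\epsilon>0$. If for each $\lambda_k$ there exist entries of $\boldsymbol\mu$, denoted $\mu_{k,1},\mu_{k,2},\mu_{k,3}$, with $|\mu_{k,t}+\overline{\lambda_k}|\le\epsilon$ for $t=1,2,3$, and no entry $\mu_{k,t}$ is repeated, then there exists a constant $C$ independent of $\epsilon$ such that $$\sin\phi_{\max}(\mathcal{T}(\boldsymbol\lambda),\mathcal{V}(\boldsymbol\mu))\le C\epsilon.$$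
   Context: $\mathcal{H}_2$ is the Hilbert space of functions analytic in the right half-plane with inner product $\langle F,G\rangle_{\mathcal{H}_2}=\frac{1}{2\pi}\int_{-\infty}^{\infty}\overline{F(\mathrm{i}\omega)}G(\mathrm{i}\omega)\,d\omega$. $\mathbb{C}_+=\{\operatorname{Re}z>0\}$, $\mathbb{C}_-=\{\operatorname{Re}z<0\}$. For $\mu\in\mathbb{C}_+$, $v[\mu](z)=(z+\overline\mu)^{-1}$ and $v[\mu]'(z)=-(z+\overline\mu)^{-2}$. Subspace angles: for finite-dimensional subspaces $\mathcal{X},\mathcal{Y}\subset\mathcal{H}_2$ of dimensions $m,n$ with unitary basis operators $B_{\mathcal{X}}:\mathbb{C}^m\to\mathcal{X}$, $B_{\mathcal{Y}}:\mathbb{C}^n\to\mathcal{Y}$, the principal angles $\phi_1\le\dots\le\phi_{\min(m,n)}$ satisfy $\cos\phi_k=\sigma_k(B_{\mathcal{X}}^*B_{\mathcal{Y}})$ (singular values in descending order), and $\phi_{\max}(\mathcal{X},\mathcal{Y})$ is the largest principal angle. *)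

(* Defs.v *)
(* MathComp-Analysis (Lebesgue integral, acos, sin) +
   real_closed complex numbers R[i] over an abstract R : realType. *)
From HB Require Import structures.
From mathcomp Require Import all_boot all_order all_algebra.
From mathcomp Require Import all_classical all_reals all_analysis.
From mathcomp Require Import complex.
Set Implicit Arguments.
Unset Strict Implicit.
Unset Printing Implicit Defensive.
Import Order.TTheory GRing.Theory Num.Theory.
Import numFieldNormedType.Exports.
Local Open Scope ring_scope.

(* functions on the complex plane; H2 elements are represented by such
   functions (only their values on the closed right half-plane matter). *)
Definition cfun (R : realType) := R[i] -> R[i].

(* v[mu](z) = (z + conj mu)^-1 and v[mu]'(z) = -(z + conj mu)^-2 *)
Definition vker (R : realType) (mu : R[i]) : cfun R :=
  fun z => (z + mu^*)^-1.
Definition dvker (R : realType) (mu : R[i]) : cfun R :=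
  fun z => - ((z + mu^*) ^+ 2)^-1.

(* <F,G>_{H2} = 1/(2 pi) int_R conj(F(i w)) G(i w) dw  (real and imaginary
   parts integrated separately w.r.t. Lebesgue measure on R) *)
Definition H2inner (R : realType) (F G : cfun R) : R[i] :=
  let h := fun w : R => (F (Complex 0 w))^* * G (Complex 0 w) in
  Complex ((2 * pi)^-1 * Rintegral (@lebesgue_measure R) setT (fun w => complex.Re (h w)))
          ((2 * pi)^-1 * Rintegral (@lebesgue_measure R) setT (fun w => complex.Im (h w))).

(* linear span of a finite family of functions *)
Definition span_of (R : realType) (m : nat) (f : 'I_m -> cfun R) : set (cfun R) :=
  [set g | exists c : 'I_m -> R[i], g = fun z => \sum_(i < m) c i * f i z].

(* e is an orthonormal basis (w.r.t. the H2 inner product) of span f;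
   equivalently B : C^d -> span f, x |-> sum x_i e_i, is unitary *)
Definition is_onb (R : realType) (m d : nat) (f : 'I_m -> cfun R)
    (e : 'I_d -> cfun R) : Prop :=
  (forall i j, H2inner (e i) (e j) = (i == j)%:R) /\ span_of e = span_of f.

(* B_X^* B_Y for orthonormal bases e of X and g of Y *)
Definition cross_mx (R : realType) (d d' : nat) (e : 'I_d -> cfun R)
    (g : 'I_d' -> cfun R) : 'M[R[i]]_(d, d') :=
  \matrix_(i < d, j < d') H2inner (e i) (g j).

Definition adjmx (R : realType) (p q : nat) (M : 'M[R[i]]_(p, q)) : 'M[R[i]]_(q, p) :=
  (map_mx Num.conj M)^T.

(* smallest eigenvalue of a (Hermitian) matrix: the least real a such that
   a is an eigenvalue *)
Definition lam_min (R : realType) (p : nat) (A : 'M[R[i]]_p) : R :=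
  inf [set a : R | eigenvalue A (Complex a 0)].

(* sigma_{min(p,q)}(M): the smallest of the min(p,q) singular values of M,
   i.e. the square root of the smallest eigenvalue of M M^* (p <= q) or of
   M^* M (q < p) *)
Definition sigma_last (R : realType) (p q : nat) (M : 'M[R[i]]_(p, q)) : R :=
  if (p <= q)%N then Num.sqrt (lam_min (M *m adjmx M))
  else Num.sqrt (lam_min (adjmx M *m M)).

(* sin of the largest principal angle phi_max = phi_{min(d,d')} between
   span e and span g, for orthonormal bases e, g: cos phi_max = sigma_last *)
Definition sin_phi_max (R : realType) (d d' : nat) (e : 'I_d -> cfun R)
    (g : 'I_d' -> cfun R) : R :=
  sin (acos (sigma_last (cross_mx e g))).

(* generating families of T(lambda) (indexed by 'I_(r + r): first the
   v[-conj lambda_j], then the v[-conj lambda_j]') and of V(mu) *)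
Definition Tfam (R : realType) (r : nat) (lam : 'I_r -> R[i]) : 'I_(r + r) -> cfun R :=
  fun i => match fintype.split i with
           | inl j => vker (- (lam j)^*)
           | inr j => dvker (- (lam j)^*)
           end.
Definition Vfam (R : realType) (n : nat) (mu : 'I_n -> R[i]) : 'I_n -> cfun R :=
  fun k => vker (mu k).

(* Main.v *)
(** If [a] is an eigenvalue of [M M^*], with [M] the cross matrix of the
orthonormal bases, an eigenvector yields [f] in T(lambda) with
[dist(f, V(mu))^2 = (1 - a) |f|^2], so it suffices to approximate every [f] in
T(lambda) from V(mu) with relative error O(eps).  For a pole [nu = - conj lambda_k]
and two distinct nodes [m1], [m2] within eps of it, [v[nu]] is approximated by
[v[m1]] and [v[nu]'] by the divided difference of [v] at [m1], [m2]; on the imaginary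
axis both errors are bounded pointwise by O(eps) times [|v[nu]|].  The coefficients
of [f] in the generating family are bounded through the diagonal of the inverse Gram
matrix, which depends on lambda only.  When eps is not small compared with the
[Re nu], the trivial bound [sin <= 1] suffices. *)
Require Import Defs.
From HB Require Import structures.
From mathcomp Require Import all_boot all_order all_algebra.
From mathcomp Require Import all_classical all_reals all_analysis.
From mathcomp Require Import complex measurable_realfun ring lra.
Import Order.TTheory GRing.Theory Num.Theory.
Import numFieldNormedType.Exports.
Local Open Scope ring_scope.
Local Notation Re := complex.Re.
Local Notation Im := complex.Im.

(** * Real-valued squared modulus of complex numbers *)

Definition csq {R : realType} (z : R[i]) : R := Re z ^+ 2 + Im z ^+ 2.

Section ComplexSquareModulus.
Context {R : realType}.
Implicit Types z w : R[i].

Lemma cReD z w : Re (z + w) = Re z + Re w. Proof. by case: z; case: w. Qed.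
Lemma cImD z w : Im (z + w) = Im z + Im w. Proof. by case: z; case: w. Qed.
Lemma cReM z w : Re (z * w) = Re z * Re w - Im z * Im w.
Proof. by case: z; case: w. Qed.
Lemma cImM z w : Im (z * w) = Re z * Im w + Im z * Re w.
Proof. by case: z; case: w. Qed.
Lemma cReN z : Re (- z) = - Re z. Proof. by case: z. Qed.
Lemma cImN z : Im (- z) = - Im z. Proof. by case: z. Qed.
Lemma cReJ z : Re z^* = Re z. Proof. by case: z. Qed.
Lemma cImJ z : Im z^* = - Im z. Proof. by case: z. Qed.
Lemma complex_ext z w : Re z = Re w -> Im z = Im w -> z = w.
Proof. by case: z => a b; case: w => c d /= -> ->. Qed.

Lemma csq_ge0 z : 0 <= csq z.
Proof. by rewrite addr_ge0 ?sqr_ge0. Qed.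

Lemma csqE z : (csq z)%:C%C = z * z^*.
Proof. by apply: complex_ext; rewrite ?cReM ?cImM cReJ cImJ /csq /=; ring. Qed.

Lemma csqC z : (csq z)%:C%C = z^* * z. Proof. by rewrite csqE mulrC. Qed.

Lemma csq_eq0 z : csq z = 0 -> z = 0.
Proof.
move=> h; have /eqP := csqE z; rewrite h eq_sym.
by rewrite mulf_eq0 conjC_eq0 orbb => /eqP.
Qed.

Lemma csq0 : csq (0 : R[i]) = 0. Proof. by rewrite /csq /= expr0n addr0. Qed.
Lemma csq1 : csq (1 : R[i]) = 1. Proof. by rewrite /csq /= expr0n expr1n addr0. Qed.
Lemma csq_conj z : csq z^* = csq z. Proof. by rewrite /csq cReJ cImJ sqrrN. Qed.
Lemma csqN z : csq (- z) = csq z. Proof. by rewrite /csq cReN cImN !sqrrN. Qed.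
Lemma csqM z w : csq (z * w) = csq z * csq w.
Proof. by rewrite /csq cReM cImM; ring. Qed.

Lemma csqV z : csq z^-1 = (csq z)^-1.
Proof.
have [->|z0] := eqVneq z 0; first by rewrite invr0 csq0 invr0.
have h : csq z^-1 * csq z = 1 by rewrite -csqM mulVf // csq1.
have n0 : csq z != 0 by apply/eqP => /csq_eq0 /eqP; rewrite (negbTE z0).
by apply: (mulIf n0); rewrite h mulVf.
Qed.

(** Parallelogram identity: the right side exceeds the left by exactly [csq (z - w)]. *)
Lemma csqD_le z w : csq (z + w) <= 2 * csq z + 2 * csq w.
Proof.
rewrite -subr_ge0 (_ : _ - _ = csq (z - w)) ?csq_ge0 //.
by rewrite /csq !cReD !cImD cReN cImN; ring.
Qed.

(** Iterating [csqD_le] doubles the factor at each term. The resulting [2 ^+ m] is crude, but it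
    depends only on the number of terms. *)
Lemma csq_sum_le (m : nat) (F : 'I_m -> R[i]) :
  csq (\sum_i F i) <= 2 ^+ m * \sum_i csq (F i).
Proof.
elim: m F => [|m ih] F; first by rewrite !big_ord0 csq0 mulr0.
rewrite !big_ord_recl; apply: le_trans (csqD_le _ _) _.
rewrite [leRHS]mulrDr lerD //.
  apply: ler_wpM2r; first exact: csq_ge0.
  by rewrite exprS ler_peMr // exprn_ege1 // ler1n.
by rewrite exprS -mulrA ler_pM2l.
Qed.

Lemma csq_normr z (eps : R) : 0 <= eps -> `|z| <= Complex eps 0 ->
  csq z <= eps ^+ 2.
Proof.
move=> e0; rewrite normc_def -/(csq z) lecR => h.
by rewrite -[csq z]sqr_sqrtr ?csq_ge0 // lerXn2r ?nnegrE ?sqrtr_ge0.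
Qed.

Lemma sqr_Re_le z : Re z ^+ 2 <= csq z.
Proof. by rewrite /csq lerDl sqr_ge0. Qed.

End ComplexSquareModulus.

(** * Square integrability on the imaginary axis *)

Definition axis {R : realType} (F : cfun R) (w : R) : R[i] := F (Complex 0 w).

(** The condition under which the integrands of [H2inner] are integrable, so that [Rintegral] acts
    linearly on them. Measurability is asked of real and imaginary parts separately because
    [H2inner] integrates them separately. *)
Definition L2axis {R : realType} (F : cfun R) : Prop :=
  [/\ measurable_fun setT (fun w => Re (axis F w)),
      measurable_fun setT (fun w => Im (axis F w)) &
      (@lebesgue_measure R).-integrable setT (fun w => (csq (axis F w))%:E)].

Section L2.
Context {R : realType}.
Notation mu := (@lebesgue_measure R).
Implicit Types F G : cfun R.

Lemma integrable_le (f g : R -> R) : measurable_fun setT f ->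
  (forall x, `|f x| <= g x) -> mu.-integrable setT (EFin \o g) ->
  mu.-integrable setT (EFin \o f).
Proof.
move=> mf fg; apply: le_integrable => //; first exact/measurable_EFinP.
move=> x _ /=; rewrite lee_fin; apply: le_trans (fg x) _; exact: ler_norm.
Qed.

Lemma integrable_scale (k : R) (f : R -> R) : mu.-integrable setT (EFin \o f) ->
  mu.-integrable setT (fun x => (k * f x)%:E).
Proof. move=> fi; exact: (integrableZl measurableT k fi). Qed.

Lemma measurable_csq {F} : measurable_fun setT (fun w => Re (axis F w)) ->
  measurable_fun setT (fun w => Im (axis F w)) ->
  measurable_fun setT (fun w => csq (axis F w)).
Proof. by move=> mr mi; apply: measurable_funD; apply: measurable_funX. Qed.

Lemma L2axis_le F (g : R -> R) : measurable_fun setT (fun w => Re (axis F w)) ->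
  measurable_fun setT (fun w => Im (axis F w)) ->
  (forall w, csq (axis F w) <= g w) -> mu.-integrable setT (EFin \o g) ->
  L2axis F.
Proof.
move=> mr mi le ig; split => //.
apply: integrable_le ig; first exact: measurable_csq.
by move=> x; rewrite ger0_norm ?csq_ge0.
Qed.

Lemma L2axisD F G : L2axis F -> L2axis G -> L2axis (fun z => F z + G z).
Proof.
move=> [f1 f2 f3] [g1 g2 g3].
apply: (@L2axis_le _ (fun w => 2 * csq (axis F w) + 2 * csq (axis G w))).
- rewrite /axis; under eq_fun do rewrite cReD; exact: measurable_funD.
- rewrite /axis; under eq_fun do rewrite cImD; exact: measurable_funD.
- by move=> w; exact: csqD_le.
- by apply: (@integrableD _ _ _ mu setT _ (fun w => (2 * csq (axis F w))%:E)
     (fun w => (2 * csq (axis G w))%:E)) => //; apply: integrable_scale.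
Qed.

Lemma L2axisZ (c : R[i]) F : L2axis F -> L2axis (fun z => c * F z).
Proof.
move=> [f1 f2 f3].
apply: (@L2axis_le _ (fun w => csq c * csq (axis F w))).
- rewrite /axis; under eq_fun do rewrite cReM.
  by apply: measurable_funB; apply: measurable_funM.
- rewrite /axis; under eq_fun do rewrite cImM.
  by apply: measurable_funD; apply: measurable_funM.
- by move=> w; rewrite /axis csqM.
- exact: integrable_scale.
Qed.

Lemma L2axis0 : L2axis (fun _ : R[i] => 0).
Proof.
apply: (@L2axis_le _ (fun=> 0)); rewrite /axis //=.
- by move=> w; rewrite csq0.
- exact: integrable0.
Qed.

Lemma L2axis_sum (m : nat) (c : 'I_m -> R[i]) (f : 'I_m -> cfun R) :
  (forall i, L2axis (f i)) -> L2axis (fun z => \sum_i c i * f i z).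
Proof.
elim: m c f => [|m ih] c f Lf.
  by under eq_fun do rewrite big_ord0; exact: L2axis0.
under eq_fun do rewrite big_ord_recl.
apply: L2axisD; first exact: L2axisZ.
exact: (ih (fun i => c (lift ord0 i)) (fun i => f (lift ord0 i))).
Qed.

Lemma L2axis_span (m : nat) (f : 'I_m -> cfun R) g :
  (forall i, L2axis (f i)) -> span_of f g -> L2axis g.
Proof. by move=> Lf [c ->]; exact: L2axis_sum. Qed.

(** The function is even, and its integral over the positive half-line is known and finite. *)
Lemma integrable_oneDsqrV :
  mu.-integrable setT (fun x : R => ((oneDsqr x)^-1)%:E).
Proof.
apply/integrableP; split.
  apply/measurable_EFinP; apply: continuous_measurable_fun.
  exact: continuous_oneDsqrV.
under eq_integral => x _.
  rewrite gee0_abs; last by rewrite lee_fin invr_ge0 (le_trans ler01) // oneDsqr_ge1.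
  over.
rewrite (@ge0_symfun_integralT R (fun x => (oneDsqr x)^-1)).
- rewrite (_ : [set x | _]%classic = `[0, +oo[%classic).
    by rewrite integral0y_oneDsqr -EFinM ltry.
  by apply/seteqP; split => x/=; rewrite in_itv/= andbT.
- by move=> x; rewrite invr_ge0 (le_trans ler01) // oneDsqr_ge1.
- exact: continuous_oneDsqrV.
- by move=> x /=; rewrite /oneDsqr sqrrN.
Qed.

Lemma Re_vker_den (m : R[i]) (w : R) : Re (Complex 0 w + m^*) = Re m.
Proof. by rewrite cReD cReJ add0r. Qed.
Lemma Im_vker_den (m : R[i]) (w : R) : Im (Complex 0 w + m^*) = w - Im m.
Proof. by rewrite cImD cImJ. Qed.

Lemma cReV (z : R[i]) : Re z^-1 = Re z / csq z.
Proof. by case: z. Qed.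
Lemma cImV (z : R[i]) : Im z^-1 = - (Im z / csq z).
Proof. by case: z. Qed.

(** Domination by a multiple of [1 / (1 + w^2)]. *)
Lemma L2axis_vker (m : R[i]) : 0 < Re m -> L2axis (vker m).
Proof.
move=> m0; set d := Re m; set s := Im m.
have csqden (w : R) : csq (Complex 0 w + m^*) = d ^+ 2 + (w - s) ^+ 2.
  by rewrite /csq Re_vker_den Im_vker_den.
have den0 (w : R) : 0 < d ^+ 2 + (w - s) ^+ 2.
  by rewrite ltr_pwDl ?sqr_ge0 // exprn_gt0.
have mV : measurable_fun setT (fun w : R => (csq (Complex 0 w + m^*))^-1).
  apply: continuous_measurable_fun => w.
  under eq_fun do rewrite csqden.
  apply: cvgV; first exact: lt0r_neq0.
  by apply: cvgD; [exact: cvg_cst|apply: cvgM; apply: cvgB => //; exact: cvg_cst].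
(* Chosen so that [1 + w^2 <= K (d^2 + (w - s)^2)]: the 2 handles [w^2 <= 2 (w - s)^2 + 2 s^2],
   whose gap is [(w - 2 s)^2], and the quotient times [d^2] supplies [1 + 2 s^2]. *)
pose K := 2 + (1 + 2 * s ^+ 2) / d ^+ 2.
apply: (@L2axis_le _ (fun w => K * (oneDsqr w)^-1)).
- rewrite /axis /vker; under eq_fun do rewrite cReV Re_vker_den.
  exact: measurable_funM.
- rewrite /axis /vker; under eq_fun do rewrite cImV Im_vker_den.
  apply: measurableT_comp => //; apply: measurable_funM => //.
  exact: measurable_funB.
- move=> w; rewrite /axis /vker csqV csqden.
  have o0 : 0 < oneDsqr w by rewrite (lt_le_trans ltr01) // oneDsqr_ge1.
  rewrite ler_pdivlMr // mulrC ler_pdivrMr // /oneDsqr.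
  have e1 : (1 + 2 * s ^+ 2) / d ^+ 2 * d ^+ 2 = 1 + 2 * s ^+ 2.
    by rewrite divfK // expf_neq0 // lt0r_neq0.
  rewrite /K mulrDl [in leRHS]mulrDr mulrDr e1.
  have : 0 <= (1 + 2 * s ^+ 2) / d ^+ 2 * (w - s) ^+ 2.
    by rewrite mulr_ge0 ?sqr_ge0 // divr_ge0 ?sqr_ge0 // addr_ge0 // mulr_ge0 // sqr_ge0.
  have := sqr_ge0 (w - 2 * s); have := sqr_ge0 d.
  nra.
- exact/integrable_scale/integrable_oneDsqrV.
Qed.

Lemma dvkerE (m : R[i]) z : dvker m z = - (vker m z * vker m z).
Proof. by rewrite /dvker /vker -invfM expr2. Qed.

Lemma csq_vker_le (m : R[i]) (w : R) : 0 < Re m ->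
  csq (axis (vker m) w) <= (Re m ^+ 2)^-1.
Proof.
move=> m0; rewrite /axis /vker csqV lef_pV2 ?posrE ?exprn_gt0 //.
  by rewrite -(Re_vker_den m w) sqr_Re_le.
by apply: lt_le_trans (sqr_Re_le _); rewrite Re_vker_den exprn_gt0.
Qed.

(** Since v' = - v^2 and v is bounded on the axis, v' is dominated by a multiple of v. *)
Lemma L2axis_dvker (m : R[i]) : 0 < Re m -> L2axis (dvker m).
Proof.
move=> m0; have [v1 v2 v3] := L2axis_vker m m0.
apply: (@L2axis_le _ (fun w => (Re m ^+ 2)^-1 * csq (axis (vker m) w))).
- rewrite /axis; under eq_fun do rewrite dvkerE cReN cReM.
  by apply: measurableT_comp => //; apply: measurable_funB; apply: measurable_funM.
- rewrite /axis; under eq_fun do rewrite dvkerE cImN cImM.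
  by apply: measurableT_comp => //; apply: measurable_funD; apply: measurable_funM.
- move=> w; rewrite /axis dvkerE csqN csqM ler_wpM2r ?csq_ge0 //.
  exact: csq_vker_le.
- exact: integrable_scale.
Qed.

End L2.

(** * Squared H2 norm and sesquilinearity of the inner product *)

Definition nsq {R : realType} (F : cfun R) : R :=
  (2 * pi)^-1 * Rintegral (@lebesgue_measure R) setT (fun w => csq (axis F w)).

Section InnerProduct.
Context {R : realType}.
Notation mu := (@lebesgue_measure R).
Implicit Types F G : cfun R.

(** Real and imaginary parts of [conj F * G] both have the form [a c + b d], so this gives them the
    integrable majorant [csq F + csq G]. *)
Lemma normr_bilin_le (a b c d : R) :
  `|a * c + b * d| <= a ^+ 2 + b ^+ 2 + (c ^+ 2 + d ^+ 2).
Proof.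
have := sqr_ge0 (a - c); have := sqr_ge0 (a + c).
have := sqr_ge0 (b - d); have := sqr_ge0 (b + d).
have := sqr_ge0 a; have := sqr_ge0 b; have := sqr_ge0 c; have := sqr_ge0 d.
by rewrite ler_norml !expr2 => *; apply/andP; split; lra.
Qed.

Lemma integrable_Re_inner {F G} : L2axis F -> L2axis G ->
  mu.-integrable setT (EFin \o (fun w => Re ((axis F w)^* * axis G w))).
Proof.
move=> [f1 f2 f3] [g1 g2 g3].
apply: (@integrable_le _ _ (fun w => csq (axis F w) + csq (axis G w))).
- under eq_fun do rewrite cReM cReJ cImJ.
  by apply: measurable_funB; apply: measurable_funM => //; exact: measurable_funN.
- by move=> w; rewrite cReM cReJ cImJ mulNr opprK; exact: normr_bilin_le.
- exact: (@integrableD _ _ _ mu setT _ (fun w => (csq (axis F w))%:E)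
     (fun w => (csq (axis G w))%:E)).
Qed.

Lemma integrable_Im_inner {F G} : L2axis F -> L2axis G ->
  mu.-integrable setT (EFin \o (fun w => Im ((axis F w)^* * axis G w))).
Proof.
move=> [f1 f2 f3] [g1 g2 g3].
apply: (@integrable_le _ _ (fun w => csq (axis F w) + csq (axis G w))).
- under eq_fun do rewrite cImM cReJ cImJ.
  by apply: measurable_funD; apply: measurable_funM => //; exact: measurable_funN.
- move=> w; rewrite cImM cReJ cImJ mulNr -mulrN; apply: le_trans (normr_bilin_le _ _ _ _) _.
  by rewrite /csq sqrrN [X in _ + X]addrC.
- exact: (@integrableD _ _ _ mu setT _ (fun w => (csq (axis F w))%:E)
     (fun w => (csq (axis G w))%:E)).
Qed.

Lemma H2innerE F G : H2inner F G =
  Complex ((2 * pi)^-1 * Rintegral mu setT (fun w => Re ((axis F w)^* * axis G w)))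
          ((2 * pi)^-1 * Rintegral mu setT (fun w => Im ((axis F w)^* * axis G w))).
Proof. by []. Qed.

Lemma H2innerDr F G H : L2axis F -> L2axis G -> L2axis H ->
  H2inner F (fun z => G z + H z) = H2inner F G + H2inner F H.
Proof.
move=> LF LG LH; rewrite !H2innerE; apply: complex_ext; rewrite ?cReD ?cImD /= -mulrDr.
- rewrite -RintegralD //; try exact: integrable_Re_inner.
  by congr (_ * _); apply: eq_Rintegral => w _; rewrite /axis mulrDr cReD.
- rewrite -RintegralD //; try exact: integrable_Im_inner.
  by congr (_ * _); apply: eq_Rintegral => w _; rewrite /axis mulrDr cImD.
Qed.

Lemma H2innerZr (c : R[i]) F G : L2axis F -> L2axis G ->
  H2inner F (fun z => c * G z) = c * H2inner F G.
Proof.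
move=> LF LG; rewrite !H2innerE.
have iR := integrable_Re_inner LF LG; have iI := integrable_Im_inner LF LG.
apply: complex_ext; rewrite ?cReM ?cImM /=.
- rewrite [X in _ = X - _]mulrCA [X in _ = _ - X]mulrCA.
  rewrite -mulrBr -[X in X - _]RintegralZl // -[X in _ - X]RintegralZl //.
  rewrite -RintegralB //; try exact: integrable_scale.
  by congr (_ * _); apply: eq_Rintegral => w _; rewrite /axis mulrCA cReM.
- rewrite [X in _ = X + _]mulrCA [X in _ = _ + X]mulrCA.
  rewrite -mulrDr -[X in _ = _ * (X + _)]RintegralZl //
    -[X in _ = _ * (_ + X)]RintegralZl // -RintegralD //; try exact: integrable_scale.
  by congr (_ * _); apply: eq_Rintegral => w _; rewrite /axis mulrCA cImM.
Qed.

Lemma H2inner_conj F G : L2axis F -> L2axis G -> H2inner F G = (H2inner G F)^*.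
Proof.
move=> LF LG; rewrite !H2innerE; apply: complex_ext; rewrite ?cReJ ?cImJ /=.
- by congr (_ * _); apply: eq_Rintegral => w _; rewrite !cReM !cReJ !cImJ; ring.
- rewrite -mulrN -[X in _ = _ * X]mulN1r -[X in _ = _ * X]RintegralZl //;
    last exact: integrable_Im_inner.
  by congr (_ * _); apply: eq_Rintegral => w _; rewrite !cImM !cReJ !cImJ; ring.
Qed.

Lemma H2inner_sumr (m : nat) F (c : 'I_m -> R[i]) (f : 'I_m -> cfun R) :
  L2axis F -> (forall i, L2axis (f i)) ->
  H2inner F (fun z => \sum_i c i * f i z) = \sum_i c i * H2inner F (f i).
Proof.
move=> LF; elim: m c f => [|m ih] c f Lf.
  (* The empty sum is written as [0 * F], so that homogeneity gives the value 0. *)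
  rewrite big_ord0 (_ : (fun z => _) = (fun z => 0 * F z)) ?H2innerZr ?mul0r //.
  by apply/funext => z; rewrite big_ord0 mul0r.
under eq_fun do rewrite big_ord_recl.
rewrite big_ord_recl H2innerDr //; last exact: L2axis_sum.
  by rewrite H2innerZr // (ih (fun i => c (lift ord0 i)) (fun i => f (lift ord0 i))).
exact: L2axisZ.
Qed.

Lemma H2inner_suml (m : nat) F (c : 'I_m -> R[i]) (f : 'I_m -> cfun R) :
  L2axis F -> (forall i, L2axis (f i)) ->
  H2inner (fun z => \sum_i c i * f i z) F = \sum_i (c i)^* * H2inner (f i) F.
Proof.
move=> LF Lf; rewrite H2inner_conj //; last exact: L2axis_sum.
rewrite H2inner_sumr // rmorph_sum; apply: eq_bigr => i _.
by rewrite rmorphM /= -H2inner_conj.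
Qed.

Lemma H2inner_self F : H2inner F F = (nsq F)%:C%C.
Proof.
rewrite H2innerE /nsq; apply: complex_ext => /=.
- by congr (_ * _); apply: eq_Rintegral => w _; rewrite -csqC.
- rewrite (_ : (fun w => _) = (fun=> 0)); last by apply/funext => w; rewrite -csqC.
  by rewrite Rintegral_cst // mul0r mulr0.
Qed.

Lemma pi2V_ge0 : 0 <= (2 * pi)^-1 :> R.
Proof. by rewrite invr_ge0 mulr_ge0 // pi_ge0. Qed.

Lemma nsq_ge0 F : 0 <= nsq F.
Proof. by rewrite mulr_ge0 ?pi2V_ge0 // Rintegral_ge0 // => w _; exact: csq_ge0. Qed.

Lemma integrable_sum_csq {m : nat} {v : 'I_m -> cfun R} (k : 'I_m -> R) :
  (forall i, L2axis (v i)) ->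
  mu.-integrable setT (EFin \o (fun w => \sum_i k i * csq (axis (v i) w))).
Proof.
move=> Lv; rewrite (_ : _ \o _ =
    (fun w => \sum_(i < m) (k i * csq (axis (v i) w))%:E)%E).
  by apply: integrable_sum => // i _; apply: integrable_scale; case: (Lv i).
by apply/funext => w; rewrite /= sumEFin.
Qed.

Lemma Rintegral_sum_csq {m : nat} {v : 'I_m -> cfun R} (k : 'I_m -> R) :
  (forall i, L2axis (v i)) ->
  Rintegral mu setT (fun w => \sum_i k i * csq (axis (v i) w)) =
  \sum_i k i * Rintegral mu setT (fun w => csq (axis (v i) w)).
Proof.
elim: m v k => [|m ih] v k Lv.
  rewrite big_ord0 (_ : (fun w => _) = (fun=> 0)).
    by rewrite Rintegral_cst // mul0r.
  by apply/funext => w; rewrite big_ord0.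
rewrite big_ord_recl; have [_ _ L0] := Lv ord0.
have iv := integrable_sum_csq (fun i => k (lift ord0 i)) (fun i => Lv (lift ord0 i)).
rewrite -RintegralZl // -(ih (fun i => v (lift ord0 i)) (fun i => k (lift ord0 i))) //.
rewrite -RintegralD //; last exact: integrable_scale.
by apply: eq_Rintegral => w _; rewrite big_ord_recl.
Qed.

(** Turns the pointwise estimates on the axis into estimates of H2 norms. *)
Lemma nsq_le_sum (m : nat) F (v : 'I_m -> cfun R) (k : 'I_m -> R) :
  L2axis F -> (forall i, L2axis (v i)) ->
  (forall w, csq (axis F w) <= \sum_i k i * csq (axis (v i) w)) ->
  nsq F <= \sum_i k i * nsq (v i).
Proof.
move=> [_ _ LF] Lv le.
rewrite /nsq; under eq_bigr do rewrite mulrCA.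
rewrite -mulr_sumr ler_wpM2l ?pi2V_ge0 // -Rintegral_sum_csq //.
by apply: le_Rintegral => //; exact: integrable_sum_csq.
Qed.

(* Completing the square: the distance from [f] to a combination of an
   orthonormal family splits into the distance to the span and a remainder. *)
Lemma nsq_sub_onb (n : nat) (g : 'I_n -> cfun R) (f : cfun R) (d : 'I_n -> R[i]) :
  L2axis f -> (forall j, L2axis (g j)) ->
  (forall i j, H2inner (g i) (g j) = (i == j)%:R) ->
  nsq (fun z => f z - \sum_j d j * g j z) =
  nsq f - \sum_j csq (H2inner f (g j)) + \sum_j csq (H2inner (g j) f - d j).
Proof.
(* The identity is moved into the complex numbers, where [nsq] becomes [H2inner] and can be
   expanded. *)
move=> Lf Lg og; apply: complexI.
rewrite rmorphD rmorphB /= !rmorph_sum -!H2inner_self /=.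
pose h := fun z => \sum_j d j * g j z.
have Lh : L2axis h by exact: L2axis_sum.
have LN F : L2axis F -> L2axis (fun z => -1 * F z) by exact: L2axisZ.
have -> : (fun z => f z - \sum_j d j * g j z) = (fun z => f z + -1 * h z).
  by apply/funext => z; rewrite mulN1r.
have LF : L2axis (fun z => f z + -1 * h z) by apply: L2axisD => //; exact: LN.
rewrite H2innerDr //; last exact: LN.
rewrite H2innerZr // [X in X + _]H2inner_conj // [X in _ + -1 * X]H2inner_conj //.
rewrite !H2innerDr //; try exact: LN.
rewrite !H2innerZr //.
have hh : H2inner h h = \sum_j (d j)^* * d j.
  rewrite {2}/h H2inner_sumr //; apply: eq_bigr => j _; rewrite mulrC; congr (_ * _).
  rewrite H2inner_suml // (bigD1 j) //= og eqxx mulr1 big1 ?addr0 // => i ij.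
  by rewrite og (negbTE ij) mulr0.
have fh : H2inner f h = \sum_j d j * H2inner f (g j) by exact: H2inner_sumr.
have hf : H2inner h f = \sum_j (d j)^* * (H2inner f (g j))^*.
  by rewrite H2inner_suml //; apply: eq_bigr => j _; rewrite [H2inner (g j) f]H2inner_conj.
rewrite !rmorphD !rmorphM /= rmorphN1 -!H2inner_conj // hh fh hf.
rewrite !mulN1r opprB -!addrA; congr (_ + _).
(* After cancelling [H2inner f f] the identity holds for each [j] separately. *)
rewrite -!sumrN -!big_split /=; apply: eq_bigr => j _.
rewrite !csqE [H2inner (g j) f]H2inner_conj // rmorphB /= conjCK.
by ring.
Qed.

End InnerProduct.

(** * Membership in spans *)

Section Span.
Context {R : realType} {m : nat} (f : 'I_m -> cfun R).

Lemma span_of_gen k : span_of f (f k).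
Proof.
exists (fun i => (i == k)%:R); apply/funext => z.
rewrite (bigD1 k) //= eqxx mul1r big1 ?addr0 // => i /negbTE ->.
by rewrite mul0r.
Qed.

Lemma span_of_sum (p : nat) (c : 'I_p -> R[i]) (h : 'I_p -> cfun R) :
  (forall i, span_of f (h i)) -> span_of f (fun z => \sum_i c i * h i z).
Proof.
move=> /choice [a ha]; exists (fun k => \sum_i c i * a i k).
apply/funext => z; under eq_bigr do rewrite ha mulr_sumr.
rewrite exchange_big; apply: eq_bigr => k _; rewrite mulr_suml.
by apply: eq_bigr => i _; rewrite mulrA.
Qed.

Lemma span_of_comb2 (a b : R[i]) (k l : 'I_m) :
  span_of f (fun z => a * f k z + b * f l z).
Proof.
rewrite (_ : (fun z => _) = (fun z => \sum_(i < 2) (if val i == 0%N then a else b) *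
    (if val i == 0%N then f k else f l) z)).
  by apply: span_of_sum => i; case: ifP => _; exact: span_of_gen.
by apply/funext => z; rewrite !big_ord_recl big_ord0 /= addr0.
Qed.

End Span.

(** * Approximating v[nu] and v[nu]' by kernels at nearby nodes *)

Section NearKernels.
Context {R : realType}.
Variables (nu : R[i]) (eps : R).
Hypothesis nu_gt0 : 0 < Re nu.
Hypothesis eps_small : 4 * eps ^+ 2 <= Re nu ^+ 2.
(** [q] bounds |v[nu]|^2 on the axis, and [eps_small] says that |eps| is at most half of [Re nu]. *)
Let q := (Re nu ^+ 2)^-1.

Let q_ge0 : 0 <= q. Proof. by rewrite invr_ge0 sqr_ge0. Qed.

Let den (m : R[i]) (w : R) : R[i] := Complex 0 w + m^*.

Let den_nu w : Re nu ^+ 2 <= csq (den nu w).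
Proof. by rewrite -(Re_vker_den nu w) sqr_Re_le. Qed.

Let den_nu_gt0 w : 0 < csq (den nu w).
Proof. by apply: lt_le_trans (den_nu w); rewrite exprn_gt0. Qed.

(** [csqD_le] leaves an error [2 eps^2], at most half of [csq (den nu w)] by [eps_small], which is
    absorbed into the left side. *)
Lemma csq_near (m : R[i]) w : csq (m - nu) <= eps ^+ 2 ->
  csq (den nu w) <= 4 * csq (den m w).
Proof.
move=> hm; have := csqD_le (den m w) (- (m - nu)^*).
rewrite csqN csq_conj (_ : den m w - _ = den nu w).
  move: eps_small hm (den_nu w); set x := csq _; set y := csq (den nu w).
  set c := csq (den m w); move: x y c (eps ^+ 2) (Re nu ^+ 2) => x y c e d *; lra.
by rewrite /den rmorphB /=; ring.
Qed.

Let den_gt0 m w : csq (m - nu) <= eps ^+ 2 -> 0 < csq (den m w).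
Proof.
move=> /(csq_near m w) /(lt_le_trans (den_nu_gt0 w)).
by rewrite pmulr_rgt0.
Qed.

Let den_neq0 m w : 0 < csq (den m w) -> den m w != 0.
Proof. by apply: contraTneq => ->; rewrite csq0 ltxx. Qed.

Let vker_near_le m w : csq (m - nu) <= eps ^+ 2 ->
  csq (axis (vker m) w) <= 4 * csq (axis (vker nu) w).
Proof.
move=> hm; rewrite /axis /vker !csqV -/(den m w) -/(den nu w).
rewrite ler_pdivlMr // ler_pdivrMl ?den_gt0 // mulrC; exact: csq_near.
Qed.

(** Resolvent identity: [1/a - 1/b = (b - a) / (a b)]. *)
Lemma vker_sub m w : csq (m - nu) <= eps ^+ 2 ->
  vker nu (Complex 0 w) - vker m (Complex 0 w) =
  (m - nu)^* * (vker nu (Complex 0 w) * vker m (Complex 0 w)).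
Proof.
move=> hm; rewrite /vker -/(den m w) -/(den nu w) -invfM.
have u0 := den_neq0 nu w (den_nu_gt0 w); have u1 := den_neq0 m w (den_gt0 m w hm).
have -> : (m - nu)^* = den m w - den nu w by rewrite /den rmorphB /=; ring.
by field; rewrite u0 u1.
Qed.

Lemma vker_near m w : csq (m - nu) <= eps ^+ 2 ->
  csq (axis (vker nu) w - axis (vker m) w) <=
  eps ^+ 2 * (4 * q) * csq (axis (vker nu) w).
Proof.
move=> hm; rewrite {1 2}/axis vker_sub // !csqM csq_conj.
have a_ge0 := csq_ge0 (axis (vker nu) w).
have b_ge0 := csq_ge0 (axis (vker m) w).
have aq := csq_vker_le nu w nu_gt0; have ba := vker_near_le m w hm.
apply: le_trans (_ : eps ^+ 2 * (csq (axis (vker nu) w) * (4 * q)) <= _); last first.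
  by rewrite le_eqVlt; apply/orP; left; apply/eqP; ring.
apply: ler_pM; rewrite ?csq_ge0 ?mulr_ge0 //; apply: ler_wpM2l => //.
by apply: le_trans ba _; rewrite ler_pM2l.
Qed.

(** The divided difference equals [- v1 v2], so the factor [1 / (m1 - m2)] cancels and the bound is
    uniform however close the two nodes are. The error [- u^2 + v1 v2] is then split by the
    resolvent identity at each node. *)
Lemma dvker_near (m1 m2 : R[i]) w : csq (m1 - nu) <= eps ^+ 2 ->
  csq (m2 - nu) <= eps ^+ 2 -> m1 != m2 ->
  csq (axis (dvker nu) w - ((m1^* - m2^*)^-1 * axis (vker m1) w +
                          - (m1^* - m2^*)^-1 * axis (vker m2) w)) <=
  eps ^+ 2 * (64 * q ^+ 2) * csq (axis (vker nu) w).
Proof.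
move=> h1 h2 m12.
have a_ge0 := csq_ge0 (axis (vker nu) w).
have b1_ge0 := csq_ge0 (axis (vker m1) w).
have b2_ge0 := csq_ge0 (axis (vker m2) w).
have aq := csq_vker_le nu w nu_gt0.
have ba1 := vker_near_le m1 w h1; have ba2 := vker_near_le m2 w h2.
pose u := axis (vker nu) w; pose v1 := axis (vker m1) w; pose v2 := axis (vker m2) w.
have -> : axis (dvker nu) w - ((m1^* - m2^*)^-1 * v1 + - (m1^* - m2^*)^-1 * v2) =
    - ((m1 - nu)^* * (u * u * v1) + (m2 - nu)^* * (u * v1 * v2)).
  have u0 := den_neq0 nu w (den_nu_gt0 w).
  have u1 := den_neq0 m1 w (den_gt0 m1 w h1).
  have u2 := den_neq0 m2 w (den_gt0 m2 w h2).
  rewrite /u /v1 /v2 /axis dvkerE /vker -/(den nu w) -/(den m1 w) -/(den m2 w).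
  have E m : (m - nu)^* = den m w - den nu w by rewrite /den rmorphB /=; ring.
  have E12 : m1^* - m2^* = den m1 w - den m2 w by rewrite /den; ring.
  rewrite !E E12; field; rewrite u0 u1 u2 /=.
  by rewrite -E12 -rmorphB conjC_eq0 subr_eq0.
rewrite csqN; apply: le_trans (csqD_le _ _) _; rewrite !csqM !csq_conj.
rewrite -/u -/v1 -/v2 in a_ge0 b1_ge0 b2_ge0 aq ba1 ba2 *.
(* Each product of three kernels costs at most two factors 4, hence 16. One factor [csq u] is kept
   and the other two are bounded by [q]. The two terms, each doubled by [csqD_le], give 64. *)
have bound c : 0 <= c <= eps ^+ 2 -> forall s, 0 <= s <= 16 * (csq u) ^+ 3 ->
    c * s <= eps ^+ 2 * (16 * (csq u * q ^+ 2)).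
  move=> /andP[c0 ce] s /andP[s0 sq]; apply: ler_pM => //.
  apply: le_trans sq _; rewrite ler_pM2l // exprS ler_wpM2l //.
  by rewrite lerXn2r ?nnegrE.
have s1 : 0 <= csq u * csq u * csq v1 <= 16 * csq u ^+ 3.
  rewrite !mulr_ge0 //=; apply: le_trans (_ : csq u * csq u * (4 * csq u) <= _).
    by apply: ler_wpM2l => //; rewrite mulr_ge0.
  rewrite (_ : _ * _ * _ = 4 * csq u ^+ 3); last by ring.
  by rewrite ler_wpM2r ?exprn_ge0 // ler_nat.
have s2 : 0 <= csq u * csq v1 * csq v2 <= 16 * csq u ^+ 3.
  rewrite !mulr_ge0 //=; apply: le_trans (_ : csq u * (4 * csq u) * (4 * csq u) <= _).
    by apply: ler_pM; rewrite ?mulr_ge0 // ler_wpM2l.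
  by rewrite le_eqVlt; apply/orP; left; apply/eqP; ring.
have c1 : 0 <= csq (m1 - nu) <= eps ^+ 2 by rewrite csq_ge0.
have c2 : 0 <= csq (m2 - nu) <= eps ^+ 2 by rewrite csq_ge0.
have B1 := bound _ c1 _ s1; have B2 := bound _ c2 _ s2.
apply: le_trans (_ : 2 * (eps ^+ 2 * (16 * (csq u * q ^+ 2))) +
  2 * (eps ^+ 2 * (16 * (csq u * q ^+ 2))) <= _); first by rewrite lerD // ler_pM2l.
by rewrite le_eqVlt; apply/orP; left; apply/eqP; ring.
Qed.

End NearKernels.

(** * From approximation error to the largest principal angle *)

Section Angles.
Context {R : realType}.

(* Writing [e = A T], orthonormality reads [conj(A) G A^T = 1] with [G] the Gram
   matrix of [T]; hence [A^T conj(A) = G^-1], a bound that does not depend on [e]. *)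
Lemma onb_coef_le (m : nat) (T e : 'I_m -> cfun R) (A : 'M[R[i]]_m) :
  (forall i, L2axis (T i)) ->
  (forall i j, H2inner (e i) (e j) = (i == j)%:R) ->
  (forall i, e i = fun z => \sum_j A i j * T j z) ->
  forall i j, csq (A i j) <= Re (invmx (cross_mx T T) j j).
Proof.
move=> LT oe eA i j; set G := cross_mx T T.
pose B := map_mx Num.conj A.
have BGA : B *m (G *m A^T) = 1%:M.
  apply/matrixP => k l; rewrite [RHS]mxE -oe (eA k) (eA l).
  rewrite H2inner_suml //; last exact: L2axis_sum.
  rewrite mxE; apply: eq_bigr => p _.
  rewrite !mxE; congr (_ * _); rewrite H2inner_sumr //.
  by apply: eq_bigr => s _; rewrite !mxE mulrC.
(* For square matrices a left inverse is also a right inverse. *)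
have GX : G *m (A^T *m B) = 1%:M by rewrite mulmxA (mulmx1C BGA).
have [Gu _] := mulmx1_unit GX.
have -> : invmx G = A^T *m B by rewrite -[invmx G]mulmx1 -GX mulKmx.
(* The diagonal entry is the squared norm of column [j] of [A], so it bounds every entry of that
   column. *)
have -> : (A^T *m B) j j = (\sum_k csq (A k j))%:C%C.
  rewrite mxE rmorph_sum; apply: eq_bigr => k _.
  by rewrite !mxE /= -csqE.
rewrite /= (bigD1 i) //= lerDl sumr_ge0 // => k _; exact: csq_ge0.
Qed.

(** The characteristic polynomial is not constant and [R[i]] is algebraically closed. *)
Lemma eigenvalue_exists (m : nat) (A : 'M[R[i]]_m) : (0 < m)%N ->
  exists a, eigenvalue A a.
Proof.
move=> m0; have : size (char_poly A) != 1%N by rewrite size_char_poly; case: (m) m0.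
by move=> /closed_rootP[a ra]; exists a; rewrite eigenvalue_root_char.
Qed.

(** For [f] built from an eigenvector, [a] is the ratio of the squared norm [S] of its projection on
    span g to its own squared norm [N]. Hence [a] is real, Bessel's inequality gives the upper
    bound, and [near] the lower one. *)
Lemma cross_eigenvalue (m n : nat) (e : 'I_m -> cfun R) (g : 'I_n -> cfun R)
    (kappa : R) (a : R[i]) :
  (forall i, L2axis (e i)) -> (forall i, L2axis (g i)) ->
  (forall i j, H2inner (e i) (e j) = (i == j)%:R) ->
  (forall i j, H2inner (g i) (g j) = (i == j)%:R) ->
  (forall x : 'I_m -> R[i], exists d : 'I_n -> R[i],
    nsq (fun z => \sum_i x i * e i z - \sum_j d j * g j z) <=
    kappa * \sum_i csq (x i)) ->
  eigenvalue (cross_mx e g *m adjmx (cross_mx e g)) a ->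
  exists b : R, a = b%:C%C /\ 1 - kappa <= b <= 1.
Proof.
move=> Le Lg oe og near /eigenvalueP[v va v0].
set M := cross_mx e g in va.
(* [H2inner] is conjugate linear on the left, so conjugated coefficients make the products of [f]
   with the [g j] the entries of [v *m M]. *)
pose x i := (v 0 i)^*; pose f := fun z => \sum_i x i * e i z.
have Lf : L2axis f by exact: L2axis_sum.
have fg j : H2inner f (g j) = (v *m M) 0 j.
  rewrite H2inner_suml // mxE; apply: eq_bigr => i _.
  by rewrite /x conjCK mxE.
have ef i : H2inner f (e i) = v 0 i.
  rewrite H2inner_suml // (bigD1 i) //= oe eqxx mulr1 /x conjCK big1 ?addr0 // => k ki.
  by rewrite oe (negbTE ki) mulr0.
pose N := \sum_i csq (v 0 i); pose S := \sum_j csq (H2inner f (g j)).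
have Nx : N = \sum_i csq (x i) by apply: eq_bigr => i _; rewrite csq_conj.
have fN : nsq f = N.
  apply: complexI; rewrite -H2inner_self {2}/f H2inner_sumr // rmorph_sum.
  by apply: eq_bigr => i _; rewrite ef /= csqC.
have N_gt0 : 0 < N.
  rewrite lt_neqAle sumr_ge0 ?andbT; last by move=> i _; exact: csq_ge0.
  apply: contra v0; rewrite eq_sym psumr_eq0; last by move=> i _; exact: csq_ge0.
  move=> /allP h; apply/eqP/rowP => i; rewrite mxE; apply: csq_eq0; apply/eqP.
  by apply: h; rewrite mem_index_enum.
have aN : a * N%:C%C = S%:C%C.
  have : ((v *m M) *m adjmx (v *m M)) 0 0 = (a *: v *m adjmx v) 0 0.
    rewrite -va /adjmx map_mxM trmx_mul !mulmxA //.
  rewrite -scalemxAl [in RHS]mxE; rewrite !mxE => aS.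
  rewrite /N /S !rmorph_sum; transitivity (a * \sum_i v 0 i * adjmx v i 0).
    by congr (_ * _); apply: eq_bigr => i _; rewrite /adjmx !mxE /= -csqE.
  by rewrite -aS; apply: eq_bigr => j _; rewrite fg /= csqE /adjmx !mxE.
have SN : S <= N.
  (* With the projection coefficients the remainder vanishes, so [N - S] is a squared norm. *)
  have := nsq_sub_onb _ g f (fun j => H2inner (g j) f) Lf Lg og.
  rewrite fN [X in _ + X]big1 ?addr0; last by move=> j _; rewrite subrr csq0.
  by rewrite -/S -subr_ge0 => <-; exact: nsq_ge0.
have [d hd] := near x.
have kN : N - S <= kappa * N.
  rewrite [X in _ <= _ * X]Nx; apply: le_trans hd.
  rewrite (nsq_sub_onb _ g f) // fN -/S lerDl sumr_ge0 // => j _; exact: csq_ge0.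
exists (S / N); split.
  have N0 : N%:C%C != 0 :> R[i] by rewrite fmorph_eq0 lt0r_neq0.
  by apply: (mulIf N0); rewrite aN -rmorphM /= divfK // lt0r_neq0.
by rewrite ler_pdivlMr // ler_pdivrMr // mul1r SN andbT mulrBl mul1r lerBlDr addrC -lerBlDr.
Qed.

Lemma sin_phi_max_le (m n : nat) (e : 'I_m -> cfun R) (g : 'I_n -> cfun R) (kappa : R) :
  (0 < m <= n)%N ->
  (forall i, L2axis (e i)) -> (forall i, L2axis (g i)) ->
  (forall i j, H2inner (e i) (e j) = (i == j)%:R) ->
  (forall i j, H2inner (g i) (g j) = (i == j)%:R) ->
  (forall x : 'I_m -> R[i], exists d : 'I_n -> R[i],
    nsq (fun z => \sum_i x i * e i z - \sum_j d j * g j z) <=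
    kappa * \sum_i csq (x i)) ->
  sin_phi_max e g <= Num.sqrt kappa.
Proof.
move=> /andP[m0 mn] Le Lg oe og near.
rewrite /sin_phi_max /sigma_last mn /lam_min.
set A := _ *m _; set E := [set b | _]%classic.
have EP b : E b -> 1 - kappa <= b <= 1.
  move=> /(cross_eigenvalue _ _ _ _ kappa _ Le Lg oe og near) [c [[->]]] //.
have [a Ea] := eigenvalue_exists _ A m0.
have [b [ab _]] := cross_eigenvalue _ _ _ _ kappa _ Le Lg oe og near Ea.
(* [E] is nonempty, so [inf E] is a genuine infimum and inherits both bounds. *)
have Eb : E b by rewrite /E /= -[Complex b 0]/(b%:C%C) -ab.
have lbE : lbound E (1 - kappa) by move=> c /EP /andP[].
have L1 : 1 - kappa <= inf E by apply: lb_le_inf => //; exists b.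
have L2 : inf E <= 1.
  by apply: le_trans (ge_inf _ Eb) _; [exists (1 - kappa)|case/andP: (EP _ Eb)].
have s1 : Num.sqrt (inf E) <= 1 by rewrite -(@sqrtr1 R) ler_wsqrtr.
rewrite sin_acos; last by rewrite s1 andbT (le_trans _ (sqrtr_ge0 _)) // lerN10.
apply: ler_wsqrtr.
(* An inequality suffices, and it also covers a negative [inf E], where [Num.sqrt] is 0 by
   default. *)
have sL : inf E <= Num.sqrt (inf E) ^+ 2.
  have [i0|i0] := leP 0 (inf E); first by rewrite sqr_sqrtr.
  by apply: le_trans (ltW i0) _; exact: sqr_ge0.
by rewrite lerBlDr -lerBlDl (le_trans _ sL).
Qed.

End Angles.

(** * Approximating the generators of T(lambda) from V(mu) *)

Section Approximation.
Context {R : realType} {r : nat} (lam : 'I_r -> R[i]).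
Hypothesis lam_lt0 : forall j, Re (lam j) < 0.

Definition node (i : 'I_(r + r)) : 'I_r :=
  match fintype.split i with inl j => j | inr j => j end.

(** Sum of the constants [4 q] of [vker_near] and [64 q^2] of [dvker_near], so that one formula
    serves both kinds of generators. *)
Definition near_const (i : 'I_(r + r)) : R :=
  4 * (Re (lam (node i)) ^+ 2)^-1 + 64 * (Re (lam (node i)) ^+ 2)^-1 ^+ 2.

Lemma Re_pole j : Re (- (lam j)^*) = - Re (lam j).
Proof. by rewrite cReN cReJ. Qed.

Lemma Re_pole_gt0 j : 0 < Re (- (lam j)^*).
Proof. by rewrite Re_pole oppr_gt0. Qed.

Lemma L2axis_Tfam i : L2axis (Tfam lam i).
Proof.
rewrite /Tfam; case: fintype.split => j.
- exact/L2axis_vker/Re_pole_gt0.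
- exact/L2axis_dvker/Re_pole_gt0.
Qed.

Lemma Tfam_near (n : nat) (mu : 'I_n -> R[i]) (idx : 'I_r -> 'I_3 -> 'I_n) (eps : R) :
  injective mu -> (forall k, injective (idx k)) ->
  (forall k t, csq (mu (idx k t) - - (lam k)^*) <= eps ^+ 2) ->
  (forall k, 4 * eps ^+ 2 <= Re (lam k) ^+ 2) ->
  forall i, exists h : cfun R, span_of (Vfam mu) h /\
    forall w, csq (axis (Tfam lam i) w - axis h w) <=
      eps ^+ 2 * near_const i * csq (axis (vker (- (lam (node i))^*)) w).
Proof.
move=> mu_inj idx_inj near small i.
have small' k : 4 * eps ^+ 2 <= Re (- (lam k)^*) ^+ 2 by rewrite Re_pole sqrrN.
have c1 k : 0 <= 4 * (Re (lam k) ^+ 2)^-1 by rewrite mulr_ge0 // invr_ge0 sqr_ge0.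
have c2 k : 0 <= 64 * (Re (lam k) ^+ 2)^-1 ^+ 2 by rewrite mulr_ge0 // sqr_ge0.
rewrite /near_const /node /Tfam; case: fintype.split => j.
- exists (vker (mu (idx j ord0))); split; first exact: (span_of_gen (Vfam mu)).
  move=> w; apply: le_trans (vker_near _ _ (Re_pole_gt0 j) (small' j) _ _ (near j ord0)) _.
  by rewrite ler_wpM2r ?csq_ge0 // ler_wpM2l ?sqr_ge0 // Re_pole sqrrN lerDl.
(* The divided difference uses the first and the last of the three nodes. *)
- pose m1 := mu (idx j ord0); pose m2 := mu (idx j ord_max).
  pose c := (m1^* - m2^*)^-1.
  exists (fun z => c * vker m1 z + - c * vker m2 z); split.
    exact: (span_of_comb2 (Vfam mu)).
  have m12 : m1 != m2 by apply/eqP => /mu_inj /idx_inj.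
  move=> w; apply: le_trans (dvker_near _ _ (Re_pole_gt0 j) (small' j) _ _ _
     (near j ord0) (near j ord_max) m12) _.
  by rewrite ler_wpM2r ?csq_ge0 // ler_wpM2l ?sqr_ge0 // Re_pole sqrrN lerDr.
Qed.

End Approximation.

(** There are [3 r] distinct nodes, so T(lambda) has the smaller dimension and [sigma_last] takes
    its [M M^*] branch. *)
Lemma leq_double_of_idx (r n : nat) (idx : 'I_r -> 'I_3 -> 'I_n) :
  (forall k t k' t', idx k t = idx k' t' -> k = k' /\ t = t') -> (r + r <= n)%N.
Proof.
move=> inj; have f_inj : injective (fun p : 'I_r * 'I_3 => idx p.1 p.2).
  by move=> [k t] [k' t'] /= /inj[-> ->].
apply: leq_trans (_ : r * 3 <= n)%N.
  by rewrite mulnC !mulSn mul0n addn0 leq_add2l leq_addr.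
by have := leq_card _ f_inj; rewrite card_prod !card_ord.
Qed.

(** * The uniform constant and the final bound *)

Theorem theorem4p2 (R : realType) (r : nat) (lam : 'I_r -> R[i]) :
  (0 < r)%N ->
  injective lam ->
  (forall j, complex.Re (lam j) < 0) ->
  exists C : R, forall eps : R, 0 < eps ->
  forall (n : nat) (mu : 'I_n -> R[i]),
    injective mu ->
    (forall k, 0 < complex.Re (mu k)) ->
  forall idx : 'I_r -> 'I_3 -> 'I_n,
    (forall k t, `|mu (idx k t) + (lam k)^*| <= Complex eps 0) ->
    (forall k t k' t', idx k t = idx k' t' -> k = k' /\ t = t') ->
  forall (e : 'I_(r + r) -> cfun R) (g : 'I_n -> cfun R),
    is_onb (Tfam lam) e -> is_onb (Vfam mu) g ->
    sin_phi_max e g <= C * eps.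
Proof.
move=> r0 _ lam_lt0; set m := (r + r)%N.
pose T := Tfam lam; pose v i := vker (- (lam (node i))^*).
pose G j := Re (invmx (cross_mx T T) j j).
(* One [2 ^+ m] comes from summing the errors over the generators, the other from bounding each
   coefficient of [f]. Everything here depends on [lam] only. *)
pose K := \sum_i 2 ^+ m * (2 ^+ m * G i) * near_const lam i * nsq (v i).
(* [D * eps < 1] forces [2 eps <= - Re (lam j)] for every [j], which is the smallness needed near
   each pole. Otherwise [D * eps] already exceeds or equals the trivial bound 1. *)
pose D := \sum_j 2 / - Re (lam j).
have D_term j : 0 <= 2 / - Re (lam j) by rewrite divr_ge0 // oppr_ge0 ltW.
exists (Num.sqrt K + D) => eps eps0 n mu mu_inj mu_gt0 idx near idx_inj e g [oe se] [og sg].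
have D0 : 0 <= D by apply: sumr_ge0 => j _.
rewrite mulrDl.
have [big|small] := leP 1 (D * eps).
  by apply: le_trans (sin_le1 _) (le_trans big _); rewrite lerDr mulr_ge0 ?sqrtr_ge0 // ltW.
apply: le_trans (_ : Num.sqrt K * eps <= _); last by rewrite lerDl mulr_ge0 // ltW.
have small_eps k : 4 * eps ^+ 2 <= Re (lam k) ^+ 2.
  have l0 : 0 < - Re (lam k) by rewrite oppr_gt0.
  have : 2 / - Re (lam k) * eps <= 1.
    apply: le_trans (ltW small); rewrite ler_wpM2r ?(ltW eps0) //.
    by rewrite /D (bigD1 k) //= lerDl sumr_ge0.
  rewrite mulrAC ler_pdivrMr // mul1r => h.
  rewrite -[X in _ <= X]sqrrN (_ : 4 * _ = (2 * eps) ^+ 2); last by ring.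
  by rewrite lerXn2r ?nnegrE ?mulr_ge0 // ltW.
have LT i : L2axis (T i) by exact: L2axis_Tfam.
have LV k : L2axis (Vfam mu k) by exact: L2axis_vker.
have Lv i : L2axis (v i) by exact/L2axis_vker/Re_pole_gt0.
have Te i : span_of T (e i) by rewrite /T -se; exact: span_of_gen.
have Le i : L2axis (e i) by exact: L2axis_span LT (Te i).
have Lg j : L2axis (g j) by apply: L2axis_span LV _; rewrite -sg; exact: span_of_gen.
have [a ea] := choice Te; pose A : 'M[R[i]]_m := \matrix_(i, j) a i j.
have AG i j : csq (a i j) <= G j.
  have -> : a i j = A i j by rewrite mxE.
  apply: (@onb_coef_le _ _ T e) => // k.
  by rewrite ea; apply/funext => z; apply: eq_bigr => l _; rewrite mxE.
have G0 i : 0 <= G i by apply: le_trans (csq_ge0 _) (AG i i).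
have near' k t : csq (mu (idx k t) - - (lam k)^*) <= eps ^+ 2.
  by rewrite opprK; apply: csq_normr (ltW eps0) (near k t).
have idx_inj' k : injective (idx k) by move=> t t' /idx_inj[].
have [h /all_and2[hV hT]] :=
  choice (Tfam_near lam lam_lt0 n mu idx eps mu_inj idx_inj' near' small_eps).
(* Matches [sin_phi_max_le] with [kappa = eps^2 K]. *)
have -> : Num.sqrt K * eps = Num.sqrt (eps ^+ 2 * K).
  by rewrite sqrtrM ?sqr_ge0 // sqrtr_sqr gtr0_norm // mulrC.
apply: sin_phi_max_le => //.
  by rewrite addn_gt0 r0 /=; exact: leq_double_of_idx idx_inj.
(* [c] holds the coordinates of [f] in the generating family [T]. Replacing each [T j] by its
   approximant [h j] gives an element of V(mu), whose coordinates in [g] are the required [d]. *)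
move=> x; pose c j := \sum_i x i * a i j.
have fE : (fun z => \sum_i x i * e i z) = (fun z => \sum_j c j * T j z).
  apply/funext => z; under eq_bigr do rewrite ea mulr_sumr.
  rewrite exchange_big; apply: eq_bigr => j _; rewrite mulr_suml.
  by apply: eq_bigr => i _; rewrite mulrA.
have : span_of g (fun z => \sum_j c j * h j z) by rewrite sg; exact: span_of_sum.
move=> [d hd]; exists d; set N := \sum_i csq (x i).
have N0 : 0 <= N by apply: sumr_ge0 => i _; exact: csq_ge0.
have cN j : csq (c j) <= 2 ^+ m * G j * N.
  apply: le_trans (csq_sum_le _ _) _; rewrite -mulrA ler_wpM2l ?exprn_ge0 //.
  rewrite mulr_sumr; apply: ler_sum => i _.
  by rewrite csqM mulrC ler_wpM2r ?csq_ge0.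
have pt w : csq (axis (fun z => \sum_i x i * e i z - \sum_j d j * g j z) w) <=
    \sum_i (eps ^+ 2 * (2 ^+ m * (2 ^+ m * G i) * near_const lam i) * N) * csq (axis (v i) w).
  rewrite /axis (congr1 (@^~ _) fE) -(congr1 (@^~ _) hd) -sumrB.
  under eq_bigr do rewrite -mulrBr.
  apply: le_trans (csq_sum_le _ _) _; rewrite mulr_sumr; apply: ler_sum => i _.
  (* Each term combines the coefficient bound [cN] with the generator error [hT]. *)
  rewrite csqM; apply: le_trans (_ : 2 ^+ m * (2 ^+ m * G i * N *
    (eps ^+ 2 * near_const lam i * csq (axis (v i) w))) <= _).
    rewrite ler_wpM2l ?exprn_ge0 //; apply: ler_pM; rewrite ?csq_ge0 //; exact: hT.
  by rewrite le_eqVlt; apply/orP; left; apply/eqP; rewrite /axis; ring.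
apply: le_trans (nsq_le_sum _ _ _ _ _ Lv pt) _.
  have -> : (fun z => \sum_i x i * e i z - \sum_j d j * g j z) =
      (fun z => \sum_i x i * e i z + -1 * (\sum_j d j * g j z)).
    by apply/funext => z; rewrite mulN1r.
  by apply: L2axisD; [exact: L2axis_sum | apply: L2axisZ; exact: L2axis_sum].
have -> : eps ^+ 2 * K * N = \sum_i eps ^+ 2 *
    (2 ^+ m * (2 ^+ m * G i) * near_const lam i) * N * nsq (v i).
  by rewrite /K [eps ^+ 2 * _]mulr_sumr mulr_suml; apply: eq_bigr => i _; ring.
exact: lexx.
Qed.
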